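(* There is a dual equivalence of categories $\mathsf{ISpace_{\Box}} \equiv^{\mathrm{op}} \mathsf{ISL_{\Box}}$ between descriptive $\Box$-frames (with general $\Box$-frame morphisms) and implicative semilattices with operators.
   Context: An implicative semilattice is a meet-semilattice with top and an operation $\to$ with $x\leq y\to z$ iff $x\wedge y\leq z$. $\mathsf{ISL_{\Box}}$: objects $(A,\Box)$ with $A$ an implicative semilattice and $\Box:A\to A$ preserving finite meets (binary meets and top); morphisms are maps preserving $\top,\wedge,\to$ and commuting with $\Box$. An I-frame is an implicative semilattice viewed as a poset; a filter is a non-empty up-closed subset closed under finite meets; $a\Rightarrow b=\{x\mid\forall y\geq x,\ y\in a\Rightarrow y\in b\}$. A $\Box$-frame is $(X,\leq,R)$, $(X,\leq)$ an I-frame, $R$ a relation with (B1) $\top Rx$ iff $x=\top$, and $xR\top$ for all $x$; (B2) $xRy\leq z\Rightarrow xRz$; (B3) $xRy,x'Ry'\Rightarrow(x\wedge x')R(y\wedge y')$; (B4) $(x\wedge x')Rz\Rightarrow\exists y,y'$ with $xRy$, $x'Ry'$, $y\wedge y'=z$. A descriptive $\Box$-frame is $(X,\leq,R,A)$ with $(X,\leq,R)$ a $\Box$-frame and $A$ a set of filters such that: $A$ is closed under $\cap$ and $\Rightarrow$; if $x\not\leq y$ some $a\in A$ contains $x$ but not $y$; every cover of $X$ by members of $A$ and their complements has a finite subcover; $A$ is closed under $p\mapsto\{x\mid R[x]\subseteq p\}$ with $R[x]=\{y\mid xRy\}$; and $R[x]=\bigcap\{a\in A\mid R[x]\subseteq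 a\}$ for all $x$. Morphisms $h:(X,\leq,R,A)\to(X',\leq',R',A')$ of $\mathsf{ISpace_{\Box}}$: maps preserving finite meets such that $h(x)\leq' y'$ implies $\exists y\geq x$, $h(y)=y'$; $xRy$ implies $h(x)R'h(y)$; $h(x)R'y'$ implies $\exists y$ with $xRy$, $h(y)=y'$; and $h^{-1}(a')\in A$ for all $a'\in A'$.
   Formalization: The set A of admissible filters of a descriptive □-frame is required to contain X (equivalently, to be non-empty); otherwise the one-point frame with A empty would count as a descriptive □-frame and the category would have no zero object, unlike ISL_□. *)

(* Defs.v *)
From HB Require Import structures.
From mathcomp Require Import all_boot all_order.
From mathcomp Require Import boolp classical_sets cardinality.

Set Implicit Arguments.
Unset Strict Implicit.
Unset Printing Implicit Defensive.

Import Order.TTheory.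

Local Open Scope classical_set_scope.
Local Open Scope order_scope.

Record category := Category {
  ob :> Type;
  hom : ob -> ob -> Type;
  idm : forall x, hom x x;
  comp : forall x y z, hom y z -> hom x y -> hom x z;
  comp1m : forall x y (f : hom x y), comp (idm y) f = f;
  compm1 : forall x y (f : hom x y), comp f (idm x) = f;
  compA : forall x y z w (h : hom z w) (g : hom y z) (f : hom x y),
    comp h (comp g f) = comp (comp h g) f }.

Arguments hom : clear implicits.
Arguments idm : clear implicits.
Arguments comp {c x y z}.

Definition op_category (C : category) : category :=
  @Category C (fun x y => hom C y x) (idm C) (fun x y z g f => comp f g)
    (fun x y f => compm1 f) (fun x y f => comp1m f)
    (fun x y z w h g f => esym (compA f g h)).

Record functor (C D : category) := Functor {
  fob :> C -> D;
  fmap : forall x y, hom C x y -> hom D (fob x) (fob y);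
  fmap1 : forall x, fmap (idm C x) = idm D (fob x);
  fmapM : forall x y z (g : hom C y z) (f : hom C x y),
    fmap (comp g f) = comp (fmap g) (fmap f) }.

Arguments fmap {C D} f0 {x y}.

Definition id_functor (C : category) : functor C C :=
  @Functor C C (fun x => x) (fun _ _ f => f) (fun=> erefl)
    (fun _ _ _ _ _ => erefl).

Definition comp_functor (C D E : category) (G : functor D E)
    (F : functor C D) : functor C E :=
  @Functor C E (fun x => G (F x)) (fun x y f => fmap G (fmap F f))
    (fun x => etrans (congr1 (fmap G) (fmap1 F x)) (fmap1 G (F x)))
    (fun x y z g f => etrans (congr1 (fmap G) (fmapM F g f))
                             (fmapM G (fmap F g) (fmap F f))).

Record natural_iso (C D : category) (F G : functor C D) := NaturalIso {
  iso_hom : forall x, hom D (F x) (G x);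
  iso_inv : forall x, hom D (G x) (F x);
  iso_homK : forall x, comp (iso_inv x) (iso_hom x) = idm D (F x);
  iso_invK : forall x, comp (iso_hom x) (iso_inv x) = idm D (G x);
  iso_natural : forall x y (f : hom C x y),
    comp (iso_hom y) (fmap F f) = comp (fmap G f) (iso_hom x) }.

Record equivalence (C D : category) := Equivalence {
  equiv_fun : functor C D;
  equiv_inv : functor D C;
  equiv_unit : natural_iso (id_functor C) (comp_functor equiv_inv equiv_fun);
  equiv_counit :
    natural_iso (comp_functor equiv_fun equiv_inv) (id_functor D) }.

Definition dually_equivalent (C D : category) : Prop :=
  inhabited (equivalence (op_category C) D).

HB.mixin Record hasImplication d T of Order.TMeetSemilattice d T := {
  imp : T -> T -> T;
  le_imp : forall x y z : T, (x <= imp y z) = (x `&` y <= z) }.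

(* The decidable equality and the choice operator that come with the order
   structures of MathComp exist classically on every type; the morphisms below
   ignore them, so they do not change the categories up to equivalence. *)
#[short(type="implSemilatticeType")]
HB.structure Definition ImplSemilattice d :=
  { T of hasImplication d T & Order.TMeetSemilattice d T }.

Definition preserves_finite_meets d d' (X : tMeetSemilatticeType d)
    (Y : tMeetSemilatticeType d') (h : X -> Y) : Prop :=
  h \top = \top /\ {morph h : x y / x `&` y}.

Record boxISL := BoxISL {
  isl_disp : Order.disp_t;
  isl_sort :> implSemilatticeType isl_disp;
  box : isl_sort -> isl_sort;
  box_meets : preserves_finite_meets box }.

Arguments box {b}.

Definition is_boxISL_morphism (A B : boxISL) (f : A -> B) : Prop :=
  [/\ preserves_finite_meets f,
      {morph f : x y / imp x y}
    & {morph f : x / box x}].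

Definition is_filter d (X : tMeetSemilatticeType d) (p : set X) : Prop :=
  [/\ p !=set0,
      forall x y, x <= y -> p x -> p y
    & forall x y, p x -> p y -> p (x `&` y)].

Definition set_imp d (X : porderType d) (a b : set X) : set X :=
  [set x | forall y, x <= y -> a y -> b y].

(* [R x] is the set of successors of x, i.e. [R x y] stands for x R y. *)
Record is_box_frame d (X : implSemilatticeType d) (R : X -> set X) : Prop :=
  IsBoxFrame {
  box_frame_top : (forall x, R \top x <-> x = \top) /\ (forall x, R x \top);
  box_frame_up : forall x y z, R x y -> y <= z -> R x z;
  box_frame_meet : forall x y x' y',
    R x y -> R x' y' -> R (x `&` x') (y `&` y');
  box_frame_split : forall x x' z, R (x `&` x') z ->
    exists y y', [/\ R x y, R x' y' & y `&` y' = z] }.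

Definition box_set (X : Type) (R : X -> set X) (p : set X) : set X :=
  [set x | R x `<=` p].

(* Closure under intersections includes the empty intersection [setT]: without
   it, the one-point frame with no admissible set at all would qualify. *)
Record is_descriptive d (X : implSemilatticeType d) (R : X -> set X)
    (A : set (set X)) : Prop := IsDescriptive {
  adm_filter : forall a, A a -> is_filter a;
  adm_setT : A setT;
  adm_setI : forall a b, A a -> A b -> A (a `&` b)%classic;
  adm_imp : forall a b, A a -> A b -> A (set_imp a b);
  adm_separated : forall x y, ~~ (x <= y) ->
    exists a, [/\ A a, a x & ~ a y];
  adm_compact : forall C : set (set X),
    C `<=` A `|` setC @` A -> cover C id = setT ->
    exists D : set (set X), [/\ D `<=` C, finite_set D & cover D id = setT];
  adm_box : forall p, A p -> A (box_set R p);
  adm_tight : forall x, R x = \bigcap_(a in [set a | A a /\ R x `<=` a]) a }.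

Record boxSpace := BoxSpace {
  space_disp : Order.disp_t;
  space_sort :> implSemilatticeType space_disp;
  space_rel : space_sort -> set space_sort;
  space_adm : set (set space_sort);
  space_box_frame : is_box_frame space_rel;
  space_descriptive : is_descriptive space_rel space_adm }.

Arguments space_rel {b}.
Arguments space_adm : clear implicits.

Record is_boxSpace_morphism (X Y : boxSpace) (h : X -> Y) : Prop :=
  IsBoxSpaceMorphism {
  space_mor_meets : preserves_finite_meets h;
  space_mor_back : forall x y', h x <= y' -> exists2 y, x <= y & h y = y';
  space_mor_rel : forall x y, space_rel x y -> space_rel (h x) (h y);
  space_mor_rel_back : forall x y', space_rel (h x) y' ->
    exists2 y, space_rel x y & h y = y';
  space_mor_adm : forall a, space_adm Y a -> space_adm X (h @^-1` a) }.

Section SigMorphisms.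
Variables (ob : Type) (car : ob -> Type).
Variable P : forall x y : ob, (car x -> car y) -> Prop.
Arguments P : clear implicits.
Hypothesis P1 : forall x, P x x id.
Hypothesis PM : forall x y z g f, P y z g -> P x y f -> P x z (g \o f).

Let homs x y := {f : car x -> car y | P x y f}.

Lemma homs_eq x y (f g : homs x y) : sval f = sval g -> f = g.
Proof. by case: f g => [f Pf] [g Pg] /= fg; exact: eq_exist. Qed.

Let idh x : homs x x := exist _ id (P1 x).

Let comph x y z (g : homs y z) (f : homs x y) : homs x z :=
  exist _ (sval g \o sval f) (PM (svalP g) (svalP f)).

Definition concrete_category : category.
Proof.
refine (@Category ob homs idh comph _ _ _).
- by move=> x y f; exact: homs_eq.
- by move=> x y f; exact: homs_eq.
- by move=> x y z w h g f; exact: homs_eq.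
Defined.

End SigMorphisms.

Lemma preserves_finite_meets_comp d1 d2 d3 (X : tMeetSemilatticeType d1)
    (Y : tMeetSemilatticeType d2) (Z : tMeetSemilatticeType d3)
    (g : Y -> Z) (f : X -> Y) :
  preserves_finite_meets g -> preserves_finite_meets f ->
  preserves_finite_meets (g \o f).
Proof.
by move=> [g1 gI] [f1 fI]; split=> [|x y] /=; rewrite ?f1 // fI gI.
Qed.

Lemma is_boxISL_morphism_id (A : boxISL) : @is_boxISL_morphism A A id.
Proof. by []. Qed.

Lemma is_boxISL_morphism_comp (A B C : boxISL) (g : B -> C) (f : A -> B) :
  is_boxISL_morphism g -> is_boxISL_morphism f -> is_boxISL_morphism (g \o f).
Proof.
move=> [gm gi gb] [fm fi fb]; split; first exact: preserves_finite_meets_comp.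
- by move=> x y /=; rewrite fi gi.
- by move=> x /=; rewrite fb gb.
Qed.

Lemma is_boxSpace_morphism_id (X : boxSpace) : @is_boxSpace_morphism X X id.
Proof. by split=> // x y xy; exists y. Qed.

Lemma is_boxSpace_morphism_comp (X Y Z : boxSpace) (g : Y -> Z) (f : X -> Y) :
  is_boxSpace_morphism g -> is_boxSpace_morphism f ->
  is_boxSpace_morphism (g \o f).
Proof.
move=> [gm gle gR gRb gA] [fm fle fR fRb fA]; split.
- exact: preserves_finite_meets_comp.
- by move=> x z /gle[y /fle[w xw <-] <-]; exists w.
- by move=> x y /fR/gR.
- by move=> x z /gRb[y /fRb[w xw <-] <-]; exists w.
- by move=> a /gA/fA.
Qed.

Definition ISL_box : category :=
  concrete_category is_boxISL_morphism_id is_boxISL_morphism_comp.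

Definition ISpace_box : category :=
  concrete_category is_boxSpace_morphism_id is_boxSpace_morphism_comp.

(* Main.v *)
(* The spectrum of A is the set of its filters ordered by inclusion, with
   admissible sets hat a = {p | a \in p}; the algebra of X is the family of its
   admissible sets.  The map a |-> hat a is an isomorphism because principal
   filters separate points.  The map eta : x |-> {a | x \in a} embeds X in the
   spectrum of its algebra by separation, and is onto by compactness: if no
   point realises a filter F, finitely many ~a (a in F) and b (b not in F) cover
   X, so some a in F is included in a finite union of filters b outside F, hence
   in one of them.  Condition (B4) for the spectrum is distributivity of the
   lattice of filters. *)
From HB Require Import structures.
From mathcomp Require Import all_boot all_order.
From mathcomp Require Import boolp classical_sets cardinality.
Require Import Defs.

Set Implicit Arguments.
Unset Strict Implicit.
Unset Printing Implicit Defensive.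

Import Order.TTheory.

Local Open Scope classical_set_scope.
Local Open Scope order_scope.

(** * Filters of a meet-semilattice: preimages, joins, finite meets of witnesses *)

Lemma is_filter_top d (X : tMeetSemilatticeType d) (p : set X) :
  is_filter p -> p \top.
Proof. by case=> -[x px] pU _; apply: pU px; exact: lex1. Qed.

Lemma is_filterI d (X : tMeetSemilatticeType d) (p q : set X) :
  is_filter p -> is_filter q -> is_filter (p `&` q)%classic.
Proof.
move=> fp fq; split.
- by exists \top; split; exact: is_filter_top.
- case: fp fq => _ pU _ [_ qU _] x y xy [px qx].
  by split; [exact: pU px|exact: qU qx].
- case: fp fq => _ _ pI [_ _ qI] x y [px qx] [py qy].
  by split; [exact: pI|exact: qI].
Qed.

Lemma is_filter_preimage d d' (X : tMeetSemilatticeType d)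
    (Y : tMeetSemilatticeType d') (f : X -> Y) (p : set Y) :
  preserves_finite_meets f -> is_filter p -> is_filter (f @^-1` p).
Proof.
move=> [f1 fI] fp; have p1 := is_filter_top fp; case: fp => _ pU pI; split.
- by exists \top; rewrite /preimage /= f1.
- move=> x y xy; apply: pU; rewrite -[in f x](meet_l xy) fI; exact: leIr.
- by move=> x y px py; rewrite /preimage /= fI; exact: pI.
Qed.

(** For a filter [p] and a non-empty [q] closed under meets, this is the filter generated by their
    union. Asking only this of [q] admits direct images of filters under homomorphisms. *)
Definition filter_join d (X : tMeetSemilatticeType d) (p q : set X) : set X :=
  [set x | exists y z, [/\ p y, q z & y `&` z <= x]].

Lemma is_filter_join d (X : tMeetSemilatticeType d) (p q : set X) :
  is_filter p -> q !=set0 -> (forall x y, q x -> q y -> q (x `&` y)) ->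
  is_filter (filter_join p q).
Proof.
move=> fp [z0 qz0] qI; have p1 := is_filter_top fp; case: fp => _ _ pI; split.
- by exists \top; exists \top, z0; split=> //; exact: lex1.
- move=> x x' xx' [y [z [py qz yz]]]; exists y, z; split=> //.
  exact: le_trans xx'.
- move=> x x' [y [z [py qz yz]]] [y' [z' [py' qz' yz']]].
  exists (y `&` y'), (z `&` z'); split; [exact: pI|exact: qI|].
  by rewrite meetACA leI2.
Qed.

Lemma filter_joinl d (X : tMeetSemilatticeType d) (p q : set X) :
  q !=set0 -> p `<=` filter_join p q.
Proof. by move=> [z qz] x px; exists x, z; split=> //; exact: leIl. Qed.

Lemma filter_joinr d (X : tMeetSemilatticeType d) (p q : set X) :
  is_filter p -> q `<=` filter_join p q.
Proof.
move=> fp x qx; exists \top, x.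
by split=> //; [exact: is_filter_top|exact: leIr].
Qed.

(** The meet of one witness per [t] stays in [p] and serves all [t] at once, because the conditions
    are inherited downwards. *)
Lemma filter_finite_witness d (X : tMeetSemilatticeType d) (p : set X) T
    (D : set T) (K : T -> set X) :
  is_filter p -> finite_set D ->
  (forall t, D t -> exists2 x, p x & forall y, y <= x -> K t y) ->
  exists2 x, p x & forall t, D t -> forall y, y <= x -> K t y.
Proof.
(* Gives [T] a choice structure classically, so that [D] can be listed as a sequence. *)
elim/Pchoice: T => T in D K *.
move=> fp /finite_seqP[s ->]; have p1 := is_filter_top fp.
case: fp => _ _ pI; elim: s => [|t s IH] DK; first by exists \top.
have [|x px Kx] := IH; first by move=> u us; apply: DK; rewrite /= inE us orbT.
have [|y py Ky] := DK t; first by rewrite /= inE eqxx.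
exists (x `&` y); first exact: pI.
move=> u /=; rewrite inE => /predU1P[->|us] z; rewrite lexI => /andP[zx zy].
  exact: Ky.
exact: Kx zx.
Qed.

(** * Families of up-closed sets as implicative semilattices *)

Section UpsetAlgebra.
Variables (d : Order.disp_t) (X : porderType d).

(** Serves both sides of the duality: all filters of an implicative semilattice give the points of
    the spectrum, and the admissible sets of a frame give its algebra. *)
Record upset_algebra := UpsetAlgebra {
  members : set (set X);
  members_up : forall a, members a -> forall x y, x <= y -> a x -> a y;
  membersT : members setT;
  membersI : forall a b, members a -> members b -> members (a `&` b)%classic;
  members_imp : forall a b, members a -> members b -> members (set_imp a b) }.

Record upset_elt (U : upset_algebra) :=
  UpsetElt { upset :> set X; upsetP : members U upset }.

Variable U : upset_algebra.

Lemma upset_inj : injective (@upset U).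
Proof.
move=> [a Pa] [b Pb] /= ab; rewrite ab in Pa *.
by congr UpsetElt; exact: Prop_irrelevance.
Qed.

Lemma upset_up (a : upset_elt U) x y : x <= y -> upset a x -> upset a y.
Proof. exact: members_up (upsetP a) x y. Qed.

End UpsetAlgebra.

Arguments UpsetElt {d X U}.

Fact upset_display : Order.disp_t. Proof. exact: Order.Disp tt tt. Qed.

Section UpsetOrder.
Variables (d : Order.disp_t) (X : porderType d) (U : upset_algebra X).
Implicit Types a b c : upset_elt U.

HB.instance Definition _ := gen_eqMixin (upset_elt U).
HB.instance Definition _ := gen_choiceMixin (upset_elt U).

Let le a b := `[< a `<=` b >].

Let le_refl : reflexive le. Proof. by move=> a; exact/asboolP. Qed.

Let le_anti : antisymmetric le.
Proof.
by move=> a b /andP[/asboolP ab /asboolP ba]; apply: upset_inj; exact/seteqP.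
Qed.

Let le_trans : transitive le.
Proof.
by move=> b a c /asboolP ab /asboolP bc; apply/asboolP; exact: subset_trans bc.
Qed.

HB.instance Definition _ :=
  Order.Le_isPOrder.Build upset_display (upset_elt U) le_refl le_anti le_trans.

Lemma le_upset a b : a <= b <-> a `<=` b.
Proof. by split=> /asboolP. Qed.

Let top : upset_elt U := UpsetElt setT (membersT U).

Let lex1 a : a <= top. Proof. exact/le_upset. Qed.

HB.instance Definition _ :=
  Order.hasTop.Build upset_display (upset_elt U) lex1.

Let meet a b : upset_elt U :=
  UpsetElt (a `&` b)%classic (membersI (upsetP a) (upsetP b)).

Let lexI a b c : (a <= meet b c) = (a <= b) && (a <= c).
Proof.
apply/idP/andP => [/le_upset abc|[/le_upset ab /le_upset ac]].
  by split; apply/le_upset => x /abc[].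
by apply/le_upset => x ax; split; [exact: ab|exact: ac].
Qed.

HB.instance Definition _ :=
  Order.POrder_isMeetSemilattice.Build upset_display (upset_elt U) lexI.

Let impl a b : upset_elt U :=
  UpsetElt (set_imp a b) (members_imp (upsetP a) (upsetP b)).

Let le_impl a b c : (a <= impl b c) = (Order.meet a b <= c).
Proof.
apply/idP/idP => /le_upset H; apply/le_upset.
  by move=> x [ax bx]; exact: (H x ax x).
by move=> x ax y xy bx; apply: H; split=> //; exact: upset_up ax.
Qed.

HB.instance Definition _ :=
  hasImplication.Build upset_display (upset_elt U) le_impl.

Lemma upsetT x : upset (\top : upset_elt U) x. Proof. by []. Qed.

End UpsetOrder.

(** * The implicative semilattice of all filters *)

Lemma is_filter_up d (X : tMeetSemilatticeType d) (p : set X) :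
  is_filter p -> forall x y, x <= y -> p x -> p y.
Proof. by case. Qed.

Lemma is_filter_setT d (X : tMeetSemilatticeType d) : is_filter [set: X].
Proof. by split=> //; exists \top. Qed.

Lemma is_filter_set_imp d (X : implSemilatticeType d) (a b : set X) :
  is_filter a -> is_filter b -> is_filter (set_imp a b).
Proof.
move=> fa fb; have b1 := is_filter_top fb.
case: fa fb => _ aU _ [_ bU bI]; split.
- by exists \top; move=> y; rewrite le1x => /eqP -> _; exact: b1.
- by move=> x x' xx' xab y x'y; apply: xab; exact: le_trans x'y.
- move=> x x' xab x'ab y xx'y ay.
  (* y = u /\ v with u := x' -> y above x and v := u -> y above x'. *)
  set u := imp x' y; set v := imp u y.
  have yu : y <= u by rewrite le_imp leIl.
  have yv : y <= v by rewrite le_imp leIl.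
  have bu : b u by apply: xab; [rewrite le_imp|exact: aU ay].
  have bv : b v by apply: x'ab; [rewrite le_imp meetC -le_imp|exact: aU ay].
  by apply: bU (bI _ _ bu bv); rewrite meetC -le_imp.
Qed.

Definition filter_algebra d (X : implSemilatticeType d) : upset_algebra X :=
  UpsetAlgebra (@is_filter_up _ X) (is_filter_setT X) (@is_filterI _ X)
    (@is_filter_set_imp _ X).

Notation filters X := (upset_elt (filter_algebra X)).

Definition mk_filter d (X : implSemilatticeType d) (p : set X)
  (fp : is_filter p) : filters X := @UpsetElt _ X (filter_algebra X) p fp.

Lemma filtersP d (X : implSemilatticeType d) (p : filters X) : is_filter p.
Proof. exact: upsetP p. Qed.

(** * Representation of elements by sets of filters *)

Definition hat d (X : implSemilatticeType d) (a : X) : set (filters X) :=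
  [set p | upset p a].

Arguments hat {d X} a.

Section Hat.
Variables (d : Order.disp_t) (X : implSemilatticeType d).
Implicit Types (a b : X) (p q : filters X).

Lemma filterU p a b : a <= b -> upset p a -> upset p b.
Proof. by case: (filtersP p) => _ + _; apply. Qed.

Lemma filterI p a b : upset p (a `&` b) <-> upset p a /\ upset p b.
Proof.
split=> [pab|[pa pb]]; last by case: (filtersP p) => _ _; apply.
by split; apply: filterU pab; [exact: leIl|exact: leIr].
Qed.

Lemma filter1 p : upset p \top.
Proof. by apply: is_filter_top; exact: filtersP. Qed.

Lemma filter_mp p a b : upset p (imp a b) -> upset p a -> upset p b.
Proof.
move=> pab pa; have /filterI := conj pa pab; apply: filterU.
by rewrite meetC -le_imp.
Qed.

Lemma is_filter_principal a : is_filter [set b | a <= b].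
Proof.
split; first by exists a => /=.
- by move=> x y xy /= ax; exact: le_trans xy.
- by move=> x y ax ay; rewrite /= lexI ax.
Qed.

Lemma hat_filter a : is_filter (hat a).
Proof.
split; first by exists \top.
- by move=> p q /le_upset pq; exact: pq.
- by move=> p q pa qa; split.
Qed.

Lemma hat_inj : injective (@hat d X).
Proof.
move=> a b /predeqP ab; apply/le_anti/andP; split.
- by have /ab := lexx a : hat a (mk_filter (is_filter_principal a)).
- by have /ab := lexx b : hat b (mk_filter (is_filter_principal b)).
Qed.

Lemma hat1 : hat (\top : X) = setT.
Proof. by apply/seteqP; split=> // p _; exact: filter1. Qed.

Lemma hatI a b : hat (a `&` b) = (hat a `&` hat b)%classic.
Proof. by apply/predeqP => p; exact: filterI. Qed.

(** For the inclusion from right to left, test on the filter generated by [p] and [a]: it contains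
    [b], so some [y] in [p] has its meet with [a] below [b], that is, [y <= imp a b]. *)
Lemma hat_imp a b : hat (imp a b) = set_imp (hat a) (hat b).
Proof.
apply/seteqP; split=> p.
  by move=> pab q /le_upset pq qa; apply: filter_mp qa; exact: pq.
have fj : is_filter (filter_join p [set c | a <= c]).
  apply: is_filter_join; first exact: filtersP.
    by exists a => /=.
  by case: (is_filter_principal a).
move=> /(_ (mk_filter fj)) [].
- by apply/le_upset; apply: filter_joinl; exists a => /=.
- by apply: filter_joinr => /=; [exact: filtersP|].
- move=> y [z [py az yzb]]; apply: filterU py; rewrite le_imp.
  by apply: le_trans yzb; exact: leI2.
Qed.

Lemma hat_separated p q : ~~ (p <= q) -> exists a, hat a p /\ ~ hat a q.
Proof.
move=> pq; apply/not_existsP => H; move/negP: pq; apply.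
by apply/le_upset => a pa; have /not_andP[|/contrapT] := H a.
Qed.

(** The elements [a] for which [hat a] and finitely many members of [C] cover the spectrum form a
    filter [F], which as a point lies in some [c] of [C]. If [c] is [hat b], then [b] is in [F] and
    [c] completes a finite cover. If [c] is the complement of [hat b], then [c] alone puts [b] in
    [F], a contradiction. *)
Lemma hat_compact (C : set (set (filters X))) :
  C `<=` range hat `|` setC @` range hat -> cover C id = setT ->
  exists D : set (set (filters X)),
    [/\ D `<=` C, finite_set D & cover D id = setT].
Proof.
move=> CA Ccov.
pose F : set X := [set a | exists D : set (set (filters X)),
  [/\ D `<=` C, finite_set D & ~` cover D id `<=` hat a]].
have fF : is_filter F.
  split.
  - exists \top, set0; split=> // p _; exact: filter1.
  - move=> a b ab [D [DC fD Da]]; exists D; split=> // p /Da; exact: filterU.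
  - move=> a b [D [DC fD Da]] [E [EC fE Eb]]; exists (D `|` E); split.
    + by move=> c [/DC|/EC].
    + by rewrite finite_setU.
    + move=> p np; apply/filterI; split.
      * by apply: Da => -[c Dc cp]; apply: np; exists c => //; left.
      * by apply: Eb => -[c Ec cp]; apply: np; exists c => //; right.
have [c Cc cF] : cover C id (mk_filter fF) by rewrite Ccov.
have [[b _ bc]|[_ [b _ <-] bc]] := CA c Cc.
- move: cF; rewrite -bc => -[D [DC fD Db]]; exists (D `|` [set c]); split.
  + by move=> e [/DC|->].
  + by rewrite finite_setU; split=> //; exact: finite_set1.
  + apply/seteqP; split=> // p _.
    have [[e De ep]|/Db bp] := pselect (cover D id p).
      by exists e => //; left.
    by exists c; [right|rewrite -bc].
- move: cF; rewrite -bc => -[]; exists [set c]; split.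
  + by move=> _ ->.
  + exact: finite_set1.
  + move=> p np; apply: contrapT => nb; apply: np.
    by exists c => //; rewrite -bc.
Qed.

End Hat.

(** * The spectrum as a descriptive frame *)

Section Spectrum.
Variable A : boxISL.
Implicit Types (a b : A) (p q : filters A).

(** The canonical relation of modal logic. The preimage of [p] under [box] is itself a filter, hence
    the least successor of [p]. *)
Definition spec_rel p : set (filters A) :=
  [set q | box @^-1` upset p `<=` upset q].

Lemma is_filter_preimage_box p : is_filter (box @^-1` upset p).
Proof.
by apply: is_filter_preimage; [exact: box_meets|exact: filtersP].
Qed.

Lemma box_set_spec_rel a : box_set spec_rel (hat a) = hat (box a).
Proof.
apply/seteqP; split=> p.
  by move/(_ (mk_filter (is_filter_preimage_box p))); apply.
by move=> pa q; apply.
Qed.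

Lemma spec_box_frame : is_box_frame spec_rel.
Proof.
split.
- split=> p; last by move=> a _; exact: upsetT.
  split=> [topp|-> a _]; last exact: upsetT.
  by apply: upset_inj; apply/seteqP; split=> a _;
    [exact: upsetT|apply: topp; exact: upsetT].
- by move=> p q r pq /le_upset qr; exact: subset_trans qr.
- move=> p q p' q' pq p'q' a [pa p'a]; split; [exact: pq|exact: p'q'].
- move=> p p' r rP.
  have rj p0 : is_filter (filter_join (upset r) (box @^-1` upset p0)).
    case: (is_filter_preimage_box p0) => n0 _ nI.
    by apply: is_filter_join => //; exact: filtersP.
  (* The witnesses are the joins of [r] with the least successors of [p] and [p']. By distributivity
     their intersection is the join of [r] with the intersection of these successors, which [rP]
     puts inside [r]. *)
  exists (mk_filter (rj p)), (mk_filter (rj p')); split.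
  + by apply: filter_joinr; exact: filtersP.
  + by apply: filter_joinr; exact: filtersP.
  + apply: upset_inj; apply/seteqP; split=> x; last first.
      move=> rx; split; apply: filter_joinl => //.
      * by case: (is_filter_preimage_box p).
      * by case: (is_filter_preimage_box p').
    move=> [[c [u [rc pu cux]]] [c' [u' [rc' pu' cux']]]].
    (* distributivity: c /\ c' -> x lies in both preimages *)
    have rcc : upset r (c `&` c') by exact/filterI.
    apply: filter_mp rcc; apply: rP; split.
    * case: (is_filter_preimage_box p) => _ bU _; apply: bU pu.
      rewrite le_imp; apply: le_trans cux.
      by rewrite meetC leI2 ?leIl.
    * case: (is_filter_preimage_box p') => _ bU _; apply: bU pu'.
      rewrite le_imp; apply: le_trans cux'.
      by rewrite meetC leI2 ?leIr.
Qed.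

Lemma spec_descriptive : is_descriptive spec_rel (range (@hat _ A)).
Proof.
split.
- by move=> _ [a _ <-]; exact: hat_filter.
- by exists \top => //; exact: hat1.
- by move=> _ _ [a _ <-] [b _ <-]; exists (a `&` b) => //; exact: hatI.
- by move=> _ _ [a _ <-] [b _ <-]; exists (imp a b) => //; exact: hat_imp.
- move=> p q /hat_separated[a [pa qa]]; by exists (hat a).
- exact: hat_compact.
- move=> _ [a _ <-]; exists (box a) => //; exact/esym/box_set_spec_rel.
- move=> p; apply/seteqP; split=> q.
    by move=> pq a [_]; apply.
  (* When [box a] is in [p], [hat a] is an admissible set containing every successor of [p]. *)
  move=> H a pa; apply: (H (hat a)); split; first by exists a.
  by move=> r; apply.
Qed.

Definition spec : boxSpace := BoxSpace spec_box_frame spec_descriptive.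

End Spectrum.

(** * Action of the spectrum on homomorphisms *)

Section SpectrumMap.
Variables (A B : boxISL) (f : A -> B).
Hypothesis fP : is_boxISL_morphism f.

Definition spec_map (p : spec B) : spec A :=
  mk_filter (is_filter_preimage (let: And3 fm _ _ := fP in fm) (filtersP p)).

(** Common source of the back conditions for the order and the relation. Take for [p'] the filter
    generated by [p] and the image of [q]. Its preimage does not exceed [q]: if [y] in [p] and [f b]
    have meet below [f a], then [f (imp b a)] is in [p], so [imp b a] is in [q]. *)
Lemma spec_map_back (p : filters B) (q : set A) :
  is_filter q -> f @^-1` upset p `<=` q ->
  exists p' : filters B, p <= p' /\ f @^-1` upset p' = q.
Proof.
case: fP => -[f1 fI] fimp fbox fq pq.
have [_ qU qI] := fq.
have fj : is_filter (filter_join (upset p) (f @` q)).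
  apply: is_filter_join; first exact: filtersP.
    by exists (f \top), \top => //; exact: is_filter_top.
  move=> _ _ [a qa <-] [b qb <-]; exists (a `&` b); last exact: fI.
  exact: qI.
exists (mk_filter fj); split.
  by apply/le_upset; apply: filter_joinl; exists (f \top), \top => //;
    exact: is_filter_top.
apply/seteqP; split=> a.
  move=> [y [_ [py [b qb <-] yba]]].
  have qba : q (imp b a) by apply: pq; rewrite /preimage /= fimp;
    apply: filterU py; rewrite le_imp.
  by apply: qU (qI _ _ qba qb); rewrite -le_imp.
by move=> qa; apply: filter_joinr; [exact: filtersP|exists a].
Qed.

Lemma spec_map_morphism : is_boxSpace_morphism spec_map.
Proof.
have [[f1 fI] fimp fbox] := fP; split.
- by split=> [|p q]; exact: upset_inj.
- move=> p q /le_upset /(spec_map_back (filtersP q))[p' [pp' p'q]].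
  by exists p' => //; exact: upset_inj.
- move=> p q pq a /=; rewrite /preimage /= fbox; exact: pq.
- move=> p q pq.
  (* Lift above the least successor of [p] rather than above [p]: the filters above it are exactly
     the successors of [p]. *)
  have [|p' [/le_upset pp' p'q]] :=
    @spec_map_back (mk_filter (is_filter_preimage_box p)) _ (filtersP q).
    by move=> a pa; apply: pq; rewrite /= /preimage /= fbox.
  by exists p' => //; exact: upset_inj.
- by move=> _ [a _ <-]; exists (f a).
Qed.

End SpectrumMap.

(** * The algebra of a descriptive frame and the isomorphism [eta] *)

Lemma adm_up (X : boxSpace) (a : set X) :
  space_adm X a -> forall x y, x <= y -> a x -> a y.
Proof. by move=> /(adm_filter (space_descriptive X))[]. Qed.

Definition adm_algebra (X : boxSpace) : upset_algebra X :=
  let D := space_descriptive X in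
  @UpsetAlgebra _ X (space_adm X) (@adm_up X) (adm_setT D) (@adm_setI _ _ _ _ D)
    (@adm_imp _ _ _ _ D).

Section Algebra.
Variable X : boxSpace.

Definition alg_box (a : upset_elt (adm_algebra X)) :
    upset_elt (adm_algebra X) :=
  @UpsetElt _ _ (adm_algebra X) (box_set space_rel (upset a))
    (adm_box (space_descriptive X) (upsetP a)).

Lemma alg_box_meets : preserves_finite_meets alg_box.
Proof.
split=> [|a b]; apply: upset_inj; apply/seteqP; split=> //= x.
- by move=> H; split=> y /H [].
- by move=> [Ha Hb] y xy; split; [exact: Ha|exact: Hb].
Qed.

Definition alg : boxISL := BoxISL alg_box_meets.

Lemma alg_filter (a : upset_elt (adm_algebra X)) : is_filter (upset a).
Proof. exact: (adm_filter (space_descriptive X) (upsetP a)). Qed.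

Lemma is_filter_nbhs (x : X) : is_filter [set a : alg | upset a x].
Proof.
split; first by exists \top.
- by move=> a b /le_upset ab ax; exact: ab.
- by move=> a b ax bx; split.
Qed.

Definition eta (x : X) : spec alg := mk_filter (is_filter_nbhs x).

Lemma eta_le x y : (eta x <= eta y) = (x <= y).
Proof.
apply/idP/idP => [/le_upset H|xy]; last first.
  by apply/le_upset => a; exact: (@upset_up _ _ (adm_algebra X) a _ _ xy).
apply/negP => /negP /(adm_separated (space_descriptive X))[a [Aa ax ay]].
by apply: ay; apply: (H (@UpsetElt _ _ (adm_algebra X) a Aa)).
Qed.

Lemma eta_inj : injective eta.
Proof. by move=> x y xy; apply/le_anti; rewrite -!eta_le xy lexx. Qed.

Lemma eta_surj (F : spec alg) : exists x, eta x = F.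
Proof.
apply: contrapT => noF.
pose C : set (set X) := (setC @` [set upset a | a in upset F])
  `|` [set upset b | b in ~` upset F].
have [D [DC finD Dcov]] : exists D : set (set X),
    [/\ D `<=` C, finite_set D & cover D id = setT].
  apply: (adm_compact (space_descriptive X)).
  - move=> _ [[_ [a Fa <-] <-]|[b Fb <-]]; last by left; exact: upsetP b.
    by right; exists (upset a) => //; exact: upsetP a.
  (* A point missed by [C] lies in exactly the members of [F], hence realises [F]. *)
  - apply/seteqP; split=> // x _; apply: contrapT => nx; apply: noF.
    exists x; apply: upset_inj; apply/seteqP; split=> a.
    + move=> ax; apply: contrapT => nFa; apply: nx; exists (upset a) => //.
      by right; exists a.
    + move=> Fa; apply: contrapT => nax; apply: nx.
      by exists (~` upset a) => //; left; exists (upset a) => //; exists a.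
(* A meet taken in the algebra: one [a] in [F] is disjoint from every complement occurring in
   [D]. *)
have [|a Fa Ka] := @filter_finite_witness _ alg (upset F) _
    (D `&` setC @` [set upset a | a in upset F])%classic
    (fun c => [set a : alg | upset a `<=` ~` c]) (filtersP F)
    (sub_finite_set (@subIsetl _ _ _) finD).
  move=> _ [_ [_ [a Fa <-] <-]]; exists a => // b /le_upset ba.
  by rewrite /= setCK.
(* A meet taken in [X]: [a] has a point outside each [b] occurring in [D]. The meet of these points
   stays in the filter [a] and, the [b] being up-closed, avoids them all, so [D] misses it. *)
have [|x ax Kx] := @filter_finite_witness _ X (upset a) _
    (D `&` [set upset b | b in ~` upset F])%classic setC (alg_filter a)
    (sub_finite_set (@subIsetl _ _ _) finD).
  move=> _ [_ [b nFb <-]].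
  have /existsNP[x /not_implyP[ax nbx]] : ~ upset a `<=` upset b.
    by move=> /le_upset ab; apply: nFb; exact: filterU Fa.
  exists x => // y yx yb; apply: nbx.
  exact: (@upset_up _ _ (adm_algebra X) b _ _ yx).
have [c Dc cx] : cover D id x by rewrite Dcov.
have [Cc|Cc] := DC c Dc; first exact: (Ka c (conj Dc Cc) a (lexx a) x).
exact: (Kx c (conj Dc Cc) x (lexx x)).
Qed.

(** Reflection is tightness: [y] is a successor of [x] as soon as it lies in every admissible set
    that contains all successors of [x]. *)
Lemma eta_rel x y : space_rel (eta x) (eta y) <-> space_rel x y.
Proof.
split=> [H|xy a]; last by apply.
rewrite (adm_tight (space_descriptive X)) => a [Aa xa].
exact: (H (@UpsetElt _ _ (adm_algebra X) a Aa)).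
Qed.

Definition eta_inv (F : spec alg) : X := sval (cid (eta_surj F)).

Lemma eta_invK : cancel eta_inv eta.
Proof. by move=> F; rewrite /eta_inv; case: cid. Qed.

Lemma etaK : cancel eta eta_inv.
Proof. by move=> x; apply: eta_inj; rewrite eta_invK. Qed.

Lemma eta_meets : preserves_finite_meets eta.
Proof.
split=> [|x y]; apply: upset_inj; apply/seteqP; split=> a //.
- by move=> _; apply: is_filter_top; exact: alg_filter.
- case: (alg_filter a) => _ aU _ axy.
  by split; apply: aU axy; [exact: leIl|exact: leIr].
- by move=> [ax ay]; case: (alg_filter a) => _ _; apply.
Qed.

(** As [eta] is a bijection that preserves and reflects the order and the relation, [eta_inv]
    supplies the witnesses of both back conditions. *)
Lemma eta_morphism : is_boxSpace_morphism eta.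
Proof.
split.
- exact: eta_meets.
- by move=> x F xF; exists (eta_inv F); rewrite -?eta_le eta_invK.
- by move=> x y xy; exact/eta_rel.
- by move=> x F xF; exists (eta_inv F); rewrite ?eta_invK // -eta_rel eta_invK.
- by move=> _ [a _ <-]; exact: upsetP a.
Qed.

Lemma eta_inv_morphism : is_boxSpace_morphism eta_inv.
Proof.
have [e1 eI] := eta_meets; split.
- split=> [|F G]; apply: eta_inj; first by rewrite eta_invK.
  by rewrite eI !eta_invK.
- move=> F y Fy; exists (eta y); last exact: etaK.
  by rewrite -[F]eta_invK eta_le.
- by move=> F G FG; apply/eta_rel; rewrite !eta_invK.
- move=> F y Fy; exists (eta y); last exact: etaK.
  by rewrite -[F]eta_invK; exact/eta_rel.
- move=> a Aa; exists (@UpsetElt _ _ (adm_algebra X) a Aa) => //.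
  apply/predeqP => F; rewrite -[F in hat _ F]eta_invK; exact: iff_refl.
Qed.

End Algebra.

(** * Action of the algebra construction on frame morphisms *)

Section AlgebraMap.
Variables (X Y : boxSpace) (h : X -> Y).
Hypothesis hP : is_boxSpace_morphism h.

Definition alg_map (a : alg Y) : alg X :=
  @UpsetElt _ _ (adm_algebra X) (h @^-1` upset a)
    (space_mor_adm hP (upsetP a)).

(** Implication and box quantify over the points above, respectively the successors. For each, the
    forth condition gives one inclusion and the back condition the other. *)
Lemma alg_map_morphism : is_boxISL_morphism alg_map.
Proof.
have [h1 hI] := space_mor_meets hP.
split; first by split=> [|a b]; exact: upset_inj.
- move=> a b; apply: upset_inj; apply/seteqP; split=> x H.
    move=> y xy; apply: H.
    by rewrite -(meet_l xy) hI; exact: leIr.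
  move=> y' /(space_mor_back hP)[y xy <-]; exact: H.
- move=> a; apply: upset_inj; apply/seteqP; split=> x H.
    by move=> y xy; apply: H; exact: (space_mor_rel hP).
  move=> y' /(space_mor_rel_back hP)[y xy <-]; exact: H.
Qed.

End AlgebraMap.

(** * The isomorphism between [A] and the algebra of its spectrum *)

Section HatIso.
Variable A : boxISL.

Definition hat_alg (a : A) : alg (spec A) :=
  @UpsetElt _ _ (adm_algebra (spec A)) (hat a) (ex_intro2 _ _ a I erefl).

Lemma hat_alg_inj : injective hat_alg.
Proof. by move=> a b /(congr1 (@upset _ _ _)) /hat_inj. Qed.

Lemma hat_alg_surj (u : alg (spec A)) : exists a, hat_alg a = u.
Proof. by have [a _ au] := upsetP u; exists a; exact: upset_inj. Qed.

Lemma hat_alg_morphism : is_boxISL_morphism hat_alg.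
Proof.
split; first split.
- by apply: upset_inj; exact: hat1.
- by move=> a b; apply: upset_inj; exact: hatI.
- by move=> a b; apply: upset_inj; exact: hat_imp.
- by move=> a; apply: upset_inj; rewrite /= box_set_spec_rel.
Qed.

Definition hat_inv (u : alg (spec A)) : A := sval (cid (hat_alg_surj u)).

Lemma hat_invK : cancel hat_inv hat_alg.
Proof. by move=> u; rewrite /hat_inv; case: cid. Qed.

Lemma hat_algK : cancel hat_alg hat_inv.
Proof. by move=> a; apply: hat_alg_inj; rewrite hat_invK. Qed.

Lemma hat_inv_morphism : is_boxISL_morphism hat_inv.
Proof.
have [[h1 hI] himp hbox] := hat_alg_morphism; split; first split.
- by apply: hat_alg_inj; rewrite hat_invK.
- by move=> u v; apply: hat_alg_inj; rewrite hI !hat_invK.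
- by move=> u v; apply: hat_alg_inj; rewrite himp !hat_invK.
- by move=> u; apply: hat_alg_inj; rewrite hbox !hat_invK.
Qed.

End HatIso.

(** * The two functors and the natural isomorphisms *)

Lemma ISL_box_eq (A B : boxISL) (f g : hom ISL_box A B) :
  sval f =1 sval g -> f = g.
Proof. by move=> fg; apply: homs_eq; exact: funext. Qed.

Lemma ISpace_box_eq (X Y : boxSpace) (f g : hom ISpace_box X Y) :
  sval f =1 sval g -> f = g.
Proof. by move=> fg; apply: homs_eq; exact: funext. Qed.

Definition alg_functor : functor (op_category ISpace_box) ISL_box.
Proof.
refine (@Functor (op_category ISpace_box) ISL_box alg (fun X Y h =>
  exist _ (alg_map (svalP h)) (alg_map_morphism (svalP h))) _ _).
- by move=> X; apply: ISL_box_eq => a; exact: (@upset_inj _ _ (adm_algebra X)).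
- move=> X Y Z g f; apply: ISL_box_eq => a.
  exact: (@upset_inj _ _ (adm_algebra Z)).
Defined.

Definition spec_functor : functor ISL_box (op_category ISpace_box).
Proof.
refine (@Functor ISL_box (op_category ISpace_box) spec (fun A B f =>
  exist _ (spec_map (svalP f)) (spec_map_morphism (svalP f))) _ _).
- by move=> A; apply: ISpace_box_eq => p; exact: upset_inj.
- by move=> A B C g f; apply: ISpace_box_eq => p; exact: upset_inj.
Defined.

(** Arrows are reversed in the opposite category, so the forward component at [X] is the frame
    morphism [eta_inv], from the double dual to [X]. *)
Definition eta_iso : natural_iso (id_functor (op_category ISpace_box))
  (comp_functor spec_functor alg_functor).
Proof.
refine (@NaturalIso (op_category ISpace_box) (op_category ISpace_box)
  (id_functor _) (comp_functor spec_functor alg_functor)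
  (fun X => exist _ (@eta_inv X) (@eta_inv_morphism X))
  (fun X => exist _ (@eta X) (@eta_morphism X)) _ _ _).
- by move=> X; apply: ISpace_box_eq => x; exact: etaK.
- by move=> X; apply: ISpace_box_eq => F; exact: eta_invK.
(* Naturality is transferred from [eta_inv] to [eta], where both sides have convertible underlying
   sets. *)
- move=> X Y f; apply: ISpace_box_eq => F /=; apply: eta_inj.
  rewrite eta_invK -[F in RHS]eta_invK; exact: upset_inj.
Defined.

Definition hat_iso : natural_iso (comp_functor alg_functor spec_functor)
  (id_functor ISL_box).
Proof.
refine (@NaturalIso ISL_box ISL_box
  (comp_functor alg_functor spec_functor) (id_functor _)
  (fun A => exist _ (@hat_inv A) (@hat_inv_morphism A))
  (fun A => exist _ (@hat_alg A) (@hat_alg_morphism A)) _ _ _).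
- by move=> A; apply: ISL_box_eq => u; exact: hat_invK.
- by move=> A; apply: ISL_box_eq => a; exact: hat_algK.
- move=> A B f; apply: ISL_box_eq => u /=; apply: hat_alg_inj.
  rewrite hat_invK -[u in LHS]hat_invK; exact: upset_inj.
Defined.

Theorem theorem5p8 : dually_equivalent ISpace_box ISL_box.
Proof. by split; exact: (Equivalence eta_iso hat_iso). Qed.
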